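(* Let $\mathbf A\in\mathcal B_1^+(\mathcal H)$, let $X\sim N_{\mathcal H}(\mathbf 0,\mathbf A)$, and let $\mathbf T\in\mathcal D(\overline{\mathcal R(\mathbf A)},\mathcal H)$ be an unbounded operator. Assume that $\mathbf T$ is closable and $\mathbf T\mathbf A^{1/2}\in\mathcal B_2(\mathcal H)$. If $\tilde{\mathbf T}$ is any extension of the closure $\overline{\mathbf T}$ of $\mathbf T$, then $\mathbb P(X\in\mathcal D(\tilde{\mathbf T}))=1$ and $$\tilde{\mathbf T}X\sim N_{\mathcal H}\big(\mathbf 0,(\mathbf T\mathbf A^{1/2})(\mathbf T\mathbf A^{1/2})^*\big).$$
   Context: $\mathcal H$ is an infinite-dimensional separable real Hilbert space. $\mathcal B_1^+(\mathcal H)$ is the set of self-adjoint positive semidefinite trace-class operators; $\mathcal B_2(\mathcal H)$ the Hilbert–Schmidt operators. $N_{\mathcal H}(\mathbf 0,\mathbf A)$ is the centered Gaussian measure on $\mathcal H$ with covariance operator $\mathbf A$. $\mathcal R$ denotes range and $\mathcal D(\mathbf T)$ the domain of $\mathbf T$. $\mathcal D(\mathcal H_1,\mathcal H)$ is the set of unbounded operators: linear maps $\mathbf T:\mathcal D(\mathbf T)\subseteq\mathcal H_1\to\mathcal H$ whose domain is a dense subspace of $\mathcal H_1$ (they are allowed to be bounded). $\tilde{\mathbf T}$ is an extension of $\mathbf T$ if its graph contains the graph of $\mathbf T$; $\mathbf T$ is closable if it has a closed extension, and its closure $\overline{\mathbf T}$ is the operator whose graph is the closure of the graph of $\mathbf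 T$. The condition $\mathbf T\mathbf A^{1/2}\in\mathcal B_2(\mathcal H)$ includes that $\mathcal R(\mathbf A^{1/2})\subset\mathcal D(\mathbf T)$. *)

(* Defs.v *)
From HB Require Import structures.
From mathcomp Require Import all_boot all_order all_algebra.
From mathcomp Require Import sesquilinear.
From mathcomp Require Import all_classical all_reals all_analysis.

Set Implicit Arguments.
Unset Strict Implicit.
Unset Printing Implicit Defensive.

Import Order.TTheory GRing.Theory Num.Theory.
Import numFieldNormedType.Exports.

Local Open Scope classical_set_scope.
Local Open Scope ring_scope.

HB.mixin Record CompleteNormedModule_isHilbert (R : realType) H
    of CompleteNormedModule R H := {
  inner : {dot H for idfun} ;
  inner_normE : forall x : H, inner x x = `|x| ^+ 2 }.

#[short(type="hilbertType")]
HB.structure Definition Hilbert (R : realType) :=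
  {H of CompleteNormedModule_isHilbert R H & CompleteNormedModule R H}.

Section hilbert_operators.
Context {R : realType} {H : hilbertType R}.
Implicit Types (A B : H -> H) (e : nat -> H).

Definition separable : Prop := exists D : set H, countable D /\ dense D.

Definition infinite_dimensional : Prop :=
  ~ exists n (v : 'I_n -> H),
      forall x, exists c : 'I_n -> R, x = \sum_(i < n) c i *: v i.

Definition orthonormal_basis e : Prop :=
  (forall i j, inner (e i) (e j) = (i == j)%:R) /\
  (forall x, series (fun k => inner x (e k) *: e k) @ \oo --> x).

Definition bounded_op A : Prop :=
  linear A /\ exists M : R, forall x, `|A x| <= M * `|x|.

Definition is_adjoint A B : Prop := forall x y, inner (A x) y = inner x (B y).

(* The adjoint exists, uniquely, as soon as A is a bounded operator. *)
Definition adjoint A : H -> H := xget (fun=> 0) (is_adjoint A).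

Definition self_adjoint A : Prop := is_adjoint A A.

Definition psd A : Prop := forall x, 0 <= inner (A x) x.

Definition is_sqrt_op A B : Prop :=
  [/\ bounded_op B, self_adjoint B, psd B & B \o B = A].

(* A^{1/2}: exists, uniquely, when A is bounded, self-adjoint and psd. *)
Definition sqrt_op A : H -> H := xget (fun=> 0) (is_sqrt_op A).

Definition abs_op A : H -> H := sqrt_op (adjoint A \o A).

(* Here and in [hilbert_schmidt], the value of the series does not depend on the
   orthonormal basis. *)
Definition trace_class A : Prop :=
  bounded_op A /\
  exists2 e, orthonormal_basis e &
    (\sum_(0 <= k <oo) (inner (abs_op A (e k)) (e k))%:E < +oo)%E.

Definition hilbert_schmidt B : Prop :=
  bounded_op B /\
  exists2 e, orthonormal_basis e &
    (\sum_(0 <= k <oo) (`|B (e k)| ^+ 2)%:E < +oo)%E.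

(* The set B_1^+(H). *)
Definition psd_trace_class A : Prop :=
  [/\ self_adjoint A, psd A & trace_class A].

End hilbert_operators.

Arguments separable {R} H.
Arguments infinite_dimensional {R} H.

(* Only the values of the underlying total function on [dom] are meaningful. *)
Record partial_op (H : Type) := PartialOp {
  dom : set H ;
  op_fun :> H -> H }.

Section unbounded_operators.
Context {R : realType} {H : hilbertType R}.
Implicit Types (S T : partial_op H).

Definition graph T : set (H * H) := [set p | dom T p.1 /\ p.2 = T p.1].

(* The class D(H1, H), for a closed subspace H1 of H. *)
Definition unbounded_op (H1 : set H) T : Prop :=
  [/\ dom T 0,
      (forall (a : R) x y, dom T x -> dom T y ->
         dom T (a *: x + y) /\ T (a *: x + y) = a *: T x + T y),
      dom T `<=` H1 & H1 `<=` closure (dom T)].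

Definition extension T S : Prop := graph T `<=` graph S.

Definition closable (H1 : set H) T : Prop :=
  exists S, [/\ unbounded_op H1 S, extension T S & closed (graph S)].

(* Its graph is the closure of the graph of T if T is closable: see
   [graph_closure_op]. *)
Definition closure_op T : partial_op H :=
  PartialOp [set x | exists y, closure (graph T) (x, y)]
             (fun x => xget 0 [set y | closure (graph T) (x, y)]).

Lemma graph_closure_op (H1 : set H) T :
  closable H1 T -> graph (closure_op T) = closure (graph T).
Proof.
move=> [S [_ TS cS]].
have TS' : closure (graph T) `<=` graph S.
  by move/closure_id: cS => ->; exact: closureS.
apply/seteqP; split=> [[x y] [/= [z xz] ->]|[x y] xy].
  by apply: (@xgetPex _ 0 [set t | closure (graph T) (x, t)]); exists z.
have xT := @xgetPex _ 0 [set t | closure (graph T) (x, t)] (ex_intro _ y xy).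
split; first by exists y.
by have [_ /= ->] := TS' _ xy; have [_ /= ->] := TS' _ xT.
Qed.

End unbounded_operators.

(* The centered normal law of variance v; [normal_prob 0 0] is not a point mass. *)
Definition normal_law {R : realType} (v : R) : set R -> \bar R :=
  if v == 0 then \d_(0 : R) else normal_prob 0 (Num.sqrt v).

Definition borelType {R : realType} (H : hilbertType R) :=
  g_sigma_algebraType (@open H).

(* mu is the centered Gaussian measure with covariance operator A: under mu every
   functional <., h> is normal with mean 0 and variance <A h, h>. *)
Definition gaussian {R : realType} {H : hilbertType R} (A : H -> H)
    (mu : set (borelType H) -> \bar R) : Prop :=
  forall (h : H) (B : set R), measurable B ->
    mu ((fun x : H => inner x h) @^-1` B) = normal_law (inner (A h) h) B.

(* The law of Z is N(0, A), for Z only almost surely defined and measurable with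
   respect to the completion of P: some Borel random variable equals Z a.s. and
   has this law. *)
Definition ae_gaussian {R : realType} {H : hilbertType R}
    (d : measure_display) (Omega : measurableType d) (P : probability Omega R)
    (A : H -> H) (Z : Omega -> H) : Prop :=
  exists Y : {RV P >-> borelType H},
    {ae P, forall w, Y w = Z w} /\ gaussian A (distribution P Y).

(* Main.v *)
From HB Require Import structures.
Require Import Defs.
From mathcomp Require Import all_boot all_order all_algebra.
From mathcomp Require Import all_classical all_reals all_analysis.
From mathcomp Require Import sesquilinear measurable_realfun ring lra.

Set Implicit Arguments.
Unset Strict Implicit.
Unset Printing Implicit Defensive.

Import Order.TTheory GRing.Theory Num.Theory.
Import numFieldNormedType.Exports.

Local Open Scope classical_set_scope.
Local Open Scope ring_scope.

(** Put B = A^{1/2}, S = T B, and C = 1 - t A with t > 0 small.  The powers C^n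
    decrease strongly to a self-adjoint operator Q with A Q = 0, so that
    Q X = 0 almost surely and X_n = X - C^n X converges to X.  Moreover
    1 - C^n = A q_n(A) for a polynomial q_n, hence X_n lies in the range of B and
    T X_n = S B q_n(A) X is a bounded operator applied to X.  Since the variance
    of <X, g> is <A g, g>, E|T X_n - T X_m|^2 is bounded by a multiple of
    ||(C^m - C^n) S^*||_HS^2, which vanishes in the limit because S is
    Hilbert-Schmidt and Q S^* = 0.  Along a subsequence T X_n therefore converges
    almost surely, and the closedness of the closure of T identifies the limit
    with the value of the extension at X.  Finally <T X_n, h> = <X, g_n> is normal
    with variance converging to |S^* h|^2; rescaled so as to have exactly this
    variance, it converges almost surely, so the limit has the same law. *)

(** * Real inner products and bounded linear maps *)

Section inner_product.
Context {R : realType} {H : hilbertType R}.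
Implicit Types (x y z : H) (U V : H -> H).

Lemma innerC x y : inner x y = inner y x.
Proof. by rewrite hermC expr0 mul1r. Qed.

Lemma innerDl x y z : inner (x + y) z = inner x z + inner y z.
Proof. exact: linearDl. Qed.

Lemma innerBl x y z : inner (x - y) z = inner x z - inner y z.
Proof. exact: linearBl. Qed.

Lemma innerZl (a : R) x y : inner (a *: x) y = a * inner x y.
Proof. exact: linearZl_LR. Qed.

Lemma innerDr x y z : inner x (y + z) = inner x y + inner x z.
Proof. exact: linearDr. Qed.

Lemma innerBr x y z : inner x (y - z) = inner x y - inner x z.
Proof. exact: linearBr. Qed.

Lemma innerZr (a : R) x y : inner x (a *: y) = a * inner x y.
Proof. by rewrite innerC innerZl innerC. Qed.

Lemma inner0l x : inner 0 x = 0.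
Proof. exact: linear0l. Qed.

Lemma inner_suml (F : nat -> H) m n y :
  inner (\sum_(m <= k < n) F k) y = \sum_(m <= k < n) inner (F k) y.
Proof. exact: linear_sumlz. Qed.

Lemma sqnormB x y : `|x - y| ^+ 2 = `|x| ^+ 2 - 2 * inner x y + `|y| ^+ 2.
Proof.
by rewrite -!inner_normE innerBl !innerBr (innerC y x); ring.
Qed.

Lemma sqnormD x y : `|x + y| ^+ 2 = `|x| ^+ 2 + 2 * inner x y + `|y| ^+ 2.
Proof.
by rewrite -!inner_normE innerDl !innerDr (innerC y x); ring.
Qed.

Lemma sqnormB_le x y : `|x - y| ^+ 2 <= 2 * `|x| ^+ 2 + 2 * `|y| ^+ 2.
Proof. by have := sqr_ge0 `|x + y|; rewrite sqnormB sqnormD; lra. Qed.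

Lemma inner_ext x y : (forall z, inner x z = inner y z) -> x = y.
Proof.
move=> xy; apply/eqP; rewrite -subr_eq0 -normr_eq0 -sqrf_eq0 -inner_normE.
by rewrite innerBl xy subrr.
Qed.

(** The squared norm of [|y|^2 x - <x,y> y] is nonnegative, and it equals [|y|^2] times the gap
    [|x|^2 |y|^2 - <x,y>^2]. *)
Lemma cauchy_schwarz x y : `|inner x y| <= `|x| * `|y|.
Proof.
have [->|y0] := eqVneq y 0; first by rewrite innerC inner0l normr0 mulr_ge0.
have yy : 0 < `|y| ^+ 2 by rewrite exprn_gt0 ?normr_gt0.
rewrite -ler_sqr ?nnegrE ?mulr_ge0// exprMn real_normK ?num_real//.
have := sqr_ge0 `| `|y| ^+ 2 *: x - inner x y *: y|.
rewrite sqnormB innerZl innerZr !normrZ !exprMn !normr_id.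
rewrite real_normK ?num_real// => h.
have : 0 <= `|y| ^+ 2 * (`|x| ^+ 2 * `|y| ^+ 2 - inner x y ^+ 2) by nra.
by rewrite pmulr_rge0// subr_ge0.
Qed.

Lemma linD U : linear U -> forall x y, U (x + y) = U x + U y.
Proof. by move=> lU x y; rewrite -{1}[x]scale1r lU scale1r. Qed.

Lemma lin0 U : linear U -> U 0 = 0.
Proof. by move=> lU; apply: (addrI (U 0)); rewrite -linD// !addr0. Qed.

Lemma linZ U : linear U -> forall (a : R) x, U (a *: x) = a *: U x.
Proof. by move=> lU a x; rewrite -[a *: x]addr0 lU lin0// addr0. Qed.

Lemma linB U : linear U -> forall x y, U (x - y) = U x - U y.
Proof. by move=> lU x y; rewrite linD// -scaleN1r linZ// scaleN1r. Qed.

Lemma lin_sum U : linear U -> forall (F : nat -> H) n,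
  U (\sum_(0 <= k < n) F k) = \sum_(0 <= k < n) U (F k).
Proof.
move=> lU F; elim=> [|n IH]; first by rewrite !big_nil lin0.
by rewrite !big_nat_recr//= linD// IH.
Qed.

Lemma lin_comp U V : linear U -> linear V -> linear (U \o V).
Proof. by move=> lU lV a x y /=; rewrite lV lU. Qed.

Lemma lin_iter U : linear U -> forall n, linear (iter n U).
Proof. by move=> lU; elim=> // n IH a x y /=; rewrite IH lU. Qed.

Lemma bounded_op_comp U V : bounded_op U -> bounded_op V -> bounded_op (U \o V).
Proof.
move=> [lU [M UM]] [lV [N VN]]; split; first exact: lin_comp.
exists (`|M| * N) => x /=; rewrite (le_trans (UM _))// -mulrA.
rewrite (@le_trans _ _ (`|M| * `|V x|))// ?ler_wpM2r ?ler_norm//.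
by rewrite ler_wpM2l.
Qed.

Lemma lipschitz_fun_continuous (W : normedModType R) (f : H -> W) (M : R) :
  (forall x y, `|f x - f y| <= M * `|x - y|) -> continuous f.
Proof.
move=> fM x; apply/cvgrPdist_lt => e e0; near=> y.
apply: le_lt_trans (fM x y) _.
apply: (@le_lt_trans _ _ ((`|M| + 1) * `|x - y|)).
  by rewrite ler_wpM2r// (le_trans (ler_norm M))// lerDl.
rewrite mulrC -ltr_pdivlMr ?ltr_wpDl//.
near: y; move: (@cvg_id _ (nbhs x)) => /cvgrPdist_lt; apply.
by rewrite divr_gt0// ltr_wpDl.
Unshelve. all: by end_near. Qed.

Lemma bounded_op_continuous U : bounded_op U -> continuous U.
Proof.
move=> [lU [M UM]]; apply: (@lipschitz_fun_continuous _ _ M) => x y.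
by rewrite -linB.
Qed.

Lemma innerl_continuous y : continuous (inner ^~ y : H -> R).
Proof.
apply: (@lipschitz_fun_continuous _ _ `|y|) => x z.
by rewrite -innerBl mulrC cauchy_schwarz.
Qed.

Lemma cvg_innerl (u : nat -> H) x y :
  u @ \oo --> x -> (fun n => inner (u n) y) @ \oo --> inner x y.
Proof.
move=> ux.
exact: (@cvg_comp _ _ _ u (inner^~ y) _ _ _ ux (@innerl_continuous y x)).
Qed.

Lemma cvg_op U (u : nat -> H) x :
  bounded_op U -> u @ \oo --> x -> (fun n => U (u n)) @ \oo --> U x.
Proof.
move=> bU ux.
exact: (@cvg_comp _ _ _ u U _ _ _ ux (@bounded_op_continuous U bU x)).
Qed.

(** Cauchy criterion by comparison: it turns monotone convergence of a scalar sequence [b] into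
    strong convergence of operators. *)
Lemma is_cvg_sqnorm (b : nat -> R) (K : R) (u : nat -> H) : cvgn b ->
  (forall m n, (m <= n)%N -> `|u n - u m| ^+ 2 <= K * `|b n - b m|) -> cvgn u.
Proof.
move=> cb bu; apply/cauchy_cvgP/cauchyP => e e0.
have /cauchy_cvgP/cauchyP cb' := cb.
(* Adding 1 to [|K|] keeps the denominator positive; the last halving is there because [b n] and
   [b N] are both compared with a common center. *)
pose d := (e ^+ 2) / (`|K| + 1) / 2.
have d0 : 0 < d by rewrite !divr_gt0// ?exprn_gt0// ltr_wpDl.
have [c] := cb' _ d0; rewrite /fmap/= => -[N _ cN].
exists (u N); exists N => // n /= Nn.
rewrite -ball_normE /= distrC -ltr_sqr ?nnegrE ?(ltW e0)//.
apply: le_lt_trans (bu _ _ Nn) _.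
have bb : `|b n - b N| < e ^+ 2 / (`|K| + 1).
  have := cN _ Nn; have := cN _ (leqnn N); rewrite /= -!ball_normE /=.
  move=> h1 h2; have -> : b n - b N = (c - b N) - (c - b n) by ring.
  by rewrite (le_lt_trans (ler_normB _ _))// [ltRHS]splitr ltrD.
apply: (@le_lt_trans _ _ ((`|K| + 1) * `|b n - b N|)).
  by rewrite ler_wpM2r// (le_trans (ler_norm K))// lerDl.
by rewrite mulrC -ltr_pdivlMr// ltr_wpDl.
Qed.

End inner_product.

(** * The operator [1 - t A] in the operator order *)

Section relaxation.
Context {R : realType} {H : hilbertType R}.
Implicit Types (x y z : H) (A U V : H -> H) (t : R).

Definition relax t A x : H := x - t *: A x.

(** Positivity of [A] tested at [y - N^-1 *: A y], where [N] bounds the norm of [A], gives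
    [t A^2 <= A] with [t = N^-1]. *)
Lemma psd_sqnorm_le A : bounded_op A -> self_adjoint A -> psd A ->
  exists2 t, 0 < t & forall y, t * `|A y| ^+ 2 <= inner (A y) y.
Proof.
move=> [lA [M AM]] sA pA; pose N := `|M| + 1.
have N0 : 0 < N by rewrite ltr_wpDl.
have MN : M <= N by rewrite (le_trans (ler_norm M))// lerDl.
exists N^-1; first by rewrite invr_gt0.
move=> y; have := pA (y - N^-1 *: A y).
rewrite linB// linZ// innerBl !innerBr !innerZl !innerZr (sA (A y)) !inner_normE.
have : inner (A (A y)) (A y) <= N * `|A y| ^+ 2.
  rewrite (le_trans (ler_norm _))// (le_trans (cauchy_schwarz _ _))//.
  by rewrite expr2 mulrA ler_wpM2r// (le_trans (AM _))// ler_wpM2r.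
move=> h1 h2.
have : N^-1 * (N^-1 * inner (A (A y)) (A y)) <= N^-1 * (N^-1 * (N * `|A y| ^+ 2)).
  by rewrite !ler_wpM2l// invr_ge0 ltW.
by rewrite (mulrA N^-1 N) mulVf ?gt_eqF// mul1r; lra.
Qed.

Variables (A : H -> H) (t : R).
Hypotheses (bA : bounded_op A) (sA : self_adjoint A) (t0 : 0 < t).
Hypothesis tA : forall y, t * `|A y| ^+ 2 <= inner (A y) y.
Local Notation C := (relax t A).

Lemma relax_linear : linear C.
Proof.
have [lA _] := bA => a x y; rewrite /relax lA scalerDr scalerBr opprD !scalerA.
by rewrite (mulrC a t) addrACA.
Qed.

Lemma relax_self_adjoint : self_adjoint C.
Proof. by move=> x y; rewrite /relax innerBl innerBr innerZl innerZr sA. Qed.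

(** After expanding the square, [tA] absorbs the term quadratic in [A]. In the operator order this
    is [C^2 <= C]; with the next lemma it gives [C^2 <= C <= 1], the source of the monotonicity of
    the powers. *)
Lemma relax_sqnorm_le y : `|C y| ^+ 2 <= inner (C y) y.
Proof.
rewrite /relax sqnormB innerZr normrZ (gtr0_norm t0) exprMn innerBl innerZl.
rewrite inner_normE [inner y (A y)]innerC.
have : t * (t * `|A y| ^+ 2) <= t * inner (A y) y by rewrite ler_wpM2l// ltW.
by rewrite expr2; lra.
Qed.

Lemma relax_inner_le y : inner (C y) y <= `|y| ^+ 2.
Proof.
rewrite /relax innerBl innerZl inner_normE gerBl pmulr_rge0//.
by rewrite (le_trans _ (tA y))// pmulr_rge0// sqr_ge0.
Qed.

Lemma relax_contraction y : `|C y| <= `|y|.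
Proof.
rewrite -ler_sqr ?nnegrE//.
exact: le_trans (relax_sqnorm_le y) (relax_inner_le y).
Qed.

End relaxation.

(** * Existence of the positive square root *)

Section square_root.
Context {R : realType} {H : hilbertType R}.
Implicit Types (x y z : H) (A C U V W : H -> H).

(* [cone C U a] holds when U = p(C) and a = p(1) for a polynomial p without
   constant term and with nonnegative coefficients. *)
Inductive cone C : (H -> H) -> R -> Prop :=
| cone0 : cone C (fun=> 0) 0
| cone_base : cone C C 1
| coneD U V a b : cone C U a -> cone C V b ->
    cone C (fun x => U x + V x) (a + b)
| coneM U V a b : cone C U a -> cone C V b -> cone C (U \o V) (a * b)
| coneZ k U a : 0 <= k -> cone C U a -> cone C (fun x => k *: U x) (k * a).

Variable C : H -> H.
Hypotheses (lC : linear C) (sC : self_adjoint C) (C1 : forall x, `|C x| <= `|x|).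

Lemma cone_linear U a : cone C U a -> linear U.
Proof.
elim=> {U a} [||U V a b _ lU _ lV|U V a b _ lU _ lV|k U a _ _ lU] // c x y.
- by rewrite scaler0 addr0.
- by rewrite lU lV scalerDr addrACA.
- by rewrite /= lV lU.
- by rewrite lU scalerDr !scalerA mulrC.
Qed.

Lemma cone_ge0 U a : cone C U a -> 0 <= a.
Proof.
elim=> {U a} [||U V a b _ ? _ ?|U V a b _ ? _ ?|k U a ? _ ?] //.
- exact: addr_ge0.
- exact: mulr_ge0.
- exact: mulr_ge0.
Qed.

(** [C] is a contraction and the coefficients are nonnegative, so the triangle inequality bounds
    [p(C)] by [p(1)]: scalar estimates control the operators. *)
Lemma cone_norm_le U a : cone C U a -> forall x, `|U x| <= a * `|x|.
Proof.
elim=> {U a} [||U V a b _ hU _ hV|U V a b cU hU _ hV|k U a k0 _ hU] x.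
- by rewrite normr0 mul0r.
- by rewrite mul1r.
- by rewrite mulrDl (le_trans (ler_normD _ _))// lerD.
- rewrite /= (le_trans (hU _))// -mulrA ler_wpM2l//; exact: cone_ge0 cU.
- by rewrite normrZ ger0_norm// -mulrA ler_wpM2l.
Qed.

Lemma cone_comm U a W : cone C U a -> linear W -> W \o C =1 C \o W ->
  W \o U =1 U \o W.
Proof.
move=> cU lW WC.
elim: cU => {U a} [||U V a b _ hU _ hV|U V a b _ hU _ hV|k U a _ _ hU] x //=.
- by rewrite lin0.
- exact: WC.
- by rewrite linD//; congr (_ + _); [exact: hU|exact: hV].
- by have /= -> := hU (V x); congr U; exact: hV.
- by rewrite linZ//; congr (_ *: _); exact: hU.
Qed.

Lemma cone_commute U V a b : cone C U a -> cone C V b -> U \o V =1 V \o U.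
Proof.
move=> cU cV; apply: (cone_comm cV (cone_linear cU)) => x.
by symmetry; apply: (cone_comm cU lC).
Qed.

(** A product of self-adjoint operators is self-adjoint once they commute, as polynomials in [C]
    do. *)
Lemma cone_self_adjoint U a : cone C U a -> self_adjoint U.
Proof.
elim=> {U a} [||U V a b _ hU _ hV|U V a b cU hU cV hV|k U a k0 _ hU] x y //.
- by rewrite inner0l innerC inner0l.
- by rewrite innerDl innerDr hU hV.
- by rewrite /= hU hV; congr (inner x _); exact: (cone_commute cV cU).
- by rewrite innerZl innerZr hU.
Qed.

(* The iteration Y' = (C + Y^2) / 2 increases to a solution of
   (1 - Y)^2 = 1 - C; [sqrt_iter1] is its value at C = 1. *)
Fixpoint sqrt_iter n : H -> H :=
  if n is n'.+1 then fun x => 2^-1 *: (C x + sqrt_iter n' (sqrt_iter n' x))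
  else fun=> 0.

Fixpoint sqrt_iter1 n : R :=
  if n is n'.+1 then 2^-1 * (1 + sqrt_iter1 n' * sqrt_iter1 n') else 0.

Let half0 : 0 <= 2^-1 :> R. Proof. by rewrite invr_ge0. Qed.

Lemma cone_sqrt_iter n : cone C (sqrt_iter n) (sqrt_iter1 n).
Proof.
elim: n => [|n IH]; first exact: cone0.
exact: coneZ half0 (coneD (cone_base C) (coneM IH IH)).
Qed.

(** The iterates commute, so [Y_{k+2} - Y_{k+1} = (Y_{k+1} - Y_k)(Y_{k+1} + Y_k) / 2]. By induction
    every increment is a polynomial in [C] with nonnegative coefficients, and increments add up. *)
Lemma cone_sqrt_iterB m n : (m <= n)%N ->
  cone C (fun x => sqrt_iter n x - sqrt_iter m x) (sqrt_iter1 n - sqrt_iter1 m).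
Proof.
have step k : cone C (fun x => sqrt_iter k.+1 x - sqrt_iter k x)
                (sqrt_iter1 k.+1 - sqrt_iter1 k).
  elim: k => [|k IH].
    have := coneZ half0 (cone_base C); congr cone.
      by apply/funext => x /=; rewrite subr0 addr0.
    by rewrite /= subr0 mul0r addr0.
  have ck := cone_sqrt_iter k; have ck1 := cone_sqrt_iter k.+1.
  have := coneZ half0 (coneM IH (coneD ck1 ck)); congr cone.
  - apply/funext => x; set S := sqrt_iter k.+1; set S' := sqrt_iter k.
    transitivity (2^-1 *: (C x + S (S x)) - 2^-1 *: (C x + S' (S' x))) => //=.
    rewrite -scalerBr opprD addrACA subrr add0r.
    have lS : linear S := cone_linear ck1.
    have lS' : linear S' := cone_linear ck.
    rewrite (linD lS) (linD lS').
    have -> : S (S' x) = S' (S x) by exact: (cone_commute ck1 ck).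
    by rewrite -/S -/S' opprD addrA addrK.
  - by rewrite /=; field.
elim: n => [|n IH]; first by rewrite leqn0 => /eqP ->;
  have := cone0 C; congr cone; [apply/funext => x|]; rewrite subrr.
rewrite leq_eqVlt => /predU1P[->|/IH cn].
  by have := cone0 C; congr cone; [apply/funext => x|]; rewrite subrr.
have := coneD (step n) cn; congr cone; [apply/funext => x|];
  by rewrite addrA subrK.
Qed.

Lemma sqrt_iter1_le1 n : sqrt_iter1 n <= 1.
Proof.
elim: n => [|n IH] //=; have := cone_ge0 (cone_sqrt_iter n) => h.
have h2 : sqrt_iter1 n * sqrt_iter1 n <= 1 by rewrite -(mulr1 1) ler_pM.
by lra.
Qed.

Lemma sqrt_iter1_homo m n : (m <= n)%N -> sqrt_iter1 m <= sqrt_iter1 n.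
Proof. by move=> mn; rewrite -subr_ge0; exact: cone_ge0 (cone_sqrt_iterB mn). Qed.

Lemma is_cvg_sqrt_iter x : cvgn (fun n => sqrt_iter n x).
Proof.
apply: (@is_cvg_sqnorm _ _ sqrt_iter1 (`|x| ^+ 2)).
  apply: nondecreasing_is_cvgn; first by move=> m n; exact: sqrt_iter1_homo.
  by exists 1 => _ [n _ <-]; exact: sqrt_iter1_le1.
move=> m n mn; have := cone_norm_le (cone_sqrt_iterB mn) x => /= h.
have d0 := cone_ge0 (cone_sqrt_iterB mn).
rewrite ger0_norm//.
apply: (@le_trans _ _ (((sqrt_iter1 n - sqrt_iter1 m) * `|x|) ^+ 2)).
  by rewrite ler_sqr ?nnegrE// mulr_ge0.
(* The scalar increment lies between 0 and 1, hence dominates its own square. *)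
rewrite exprMn mulrC ler_wpM2l ?sqr_ge0// expr2 ler_piMl//.
have := sqrt_iter1_le1 n; have := cone_ge0 (cone_sqrt_iter m); lra.
Qed.

Definition sqrt_lim x : H := limn (fun n => sqrt_iter n x).

Lemma cvg_sqrt_iter x : (fun n => sqrt_iter n x) @ \oo --> sqrt_lim x.
Proof. exact: is_cvg_sqrt_iter. Qed.

Lemma sqrt_lim_linear : linear sqrt_lim.
Proof.
move=> a x y; apply: cvg_lim => //.
rewrite (_ : (fun n => _) = (fun n => a *: sqrt_iter n x + sqrt_iter n y)).
  by apply: cvgD; [apply: cvgZl_tmp|]; exact: cvg_sqrt_iter.
by apply/funext => n; rewrite (cone_linear (cone_sqrt_iter n)).
Qed.

Lemma sqrt_iter_contraction n x : `|sqrt_iter n x| <= `|x|.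
Proof.
rewrite (le_trans (cone_norm_le (cone_sqrt_iter n) x))// ler_piMl//.
exact: sqrt_iter1_le1.
Qed.

Lemma sqrt_lim_contraction x : `|sqrt_lim x| <= `|x|.
Proof.
have h : (fun n => `|sqrt_iter n x|) @ \oo --> `|sqrt_lim x|.
  by apply: cvg_norm; exact: cvg_sqrt_iter.
rewrite -(cvg_lim _ h)//; apply: limr_le; first by apply/cvg_ex; eexists; exact: h.
by near=> n; exact: sqrt_iter_contraction.
Unshelve. all: by end_near. Qed.

Lemma sqrt_lim_self_adjoint : self_adjoint sqrt_lim.
Proof.
move=> x y; have h := @cvg_innerl _ _ _ _ y (@cvg_sqrt_iter x).
rewrite -(cvg_lim _ h)//; apply: cvg_lim => //.
rewrite innerC (_ : (fun n => _) = fun n => inner (sqrt_iter n y) x).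
  exact: (@cvg_innerl _ _ _ _ x (@cvg_sqrt_iter y)).
by apply/funext => n; rewrite innerC (cone_self_adjoint (cone_sqrt_iter n)).
Qed.

Lemma sqrt_lim_eq x : 2 *: sqrt_lim x = C x + sqrt_lim (sqrt_lim x).
Proof.
have lim2 : (fun n => sqrt_iter n (sqrt_iter n x)) @ \oo --> sqrt_lim (sqrt_lim x).
  (* Operator and argument vary together; as every [sqrt_iter n] is a contraction, the change of
     argument costs at most [|sqrt_iter n x - sqrt_lim x|]. *)
  rewrite (_ : (fun n => _) = (fun n => sqrt_iter n (sqrt_iter n x - sqrt_lim x)
      + sqrt_iter n (sqrt_lim x))); last first.
    apply/funext => n.
    by rewrite -(linD (cone_linear (cone_sqrt_iter n))) subrK.
  rewrite -[X in _ --> X]add0r; apply: cvgD; last exact: cvg_sqrt_iter.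
  have h : (fun n => `|sqrt_iter n x - sqrt_lim x|) @ \oo --> (0 : R).
    rewrite -(@normr0 _ H); apply: cvg_norm; rewrite -(subrr (sqrt_lim x)).
    by apply: cvgB; [exact: cvg_sqrt_iter|exact: cvg_cst].
  apply: norm_cvg0; apply: (squeeze_cvgr _ (cvg_cst 0) h).
  by near=> n; rewrite normr_ge0 sqrt_iter_contraction.
have h1 : (fun n => 2^-1 *: (C x + sqrt_iter n (sqrt_iter n x))) @ \oo -->
    2^-1 *: (C x + sqrt_lim (sqrt_lim x)).
  by apply: cvgZl_tmp; apply: cvgD => //; exact: cvg_cst.
have h2 : (fun n => sqrt_iter n.+1 x) @ \oo --> sqrt_lim x.
  by have := @cvg_sqrt_iter x; rewrite -cvg_shiftS.
rewrite [in LHS](cvg_unique _ h2 h1)//= scalerA divff// scale1r.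
Unshelve. all: by end_near. Qed.

End square_root.

(** The equation [sqrt_lim_eq] reads [(1 - Y)^2 = 1 - C = t A], so [t^(-1/2) (1 - Y)] is a square
    root of [A]; it is positive because [Y] is a contraction. *)
Lemma is_sqrt_sqrt_op (R : realType) (H : hilbertType R) (A : H -> H) :
  bounded_op A -> self_adjoint A -> psd A -> is_sqrt_op A (sqrt_op A).
Proof.
move=> bA sA pA; apply: xgetPex.
have [t t0 tA] := psd_sqnorm_le bA sA pA.
have lC := @relax_linear _ _ _ t bA.
have sC := @relax_self_adjoint _ _ _ t sA.
have C1 := relax_contraction t0 tA.
pose Y := sqrt_lim (relax t A); pose s := Num.sqrt t^-1.
have lY : linear Y := sqrt_lim_linear lC C1.
have sY : self_adjoint Y := sqrt_lim_self_adjoint lC sC C1.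
have Y1 : forall x, `|Y x| <= `|x| := sqrt_lim_contraction lC C1.
have Ye : forall x, _ = _ := sqrt_lim_eq lC C1.
have lB : linear (fun x => s *: (x - Y x)).
  by move=> a x y; rewrite lY opprD addrACA -scalerBr scalerDr !scalerA mulrC.
exists (fun x => s *: (x - Y x)); split.
- split=> //; exists (s * 2) => x.
  rewrite normrZ ger0_norm ?sqrtr_ge0// -mulrA ler_wpM2l ?sqrtr_ge0//.
  by rewrite mulr_natl mulr2n (le_trans (ler_normB _ _))// lerD2l.
- by move=> x y; rewrite innerZl innerZr innerBl innerBr sY.
- move=> x; rewrite innerZl mulr_ge0 ?sqrtr_ge0// innerBl inner_normE subr_ge0.
  rewrite (le_trans (ler_norm _))// (le_trans (cauchy_schwarz _ _))//.
  by rewrite expr2 ler_wpM2r.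
- apply/funext => x /=.
  rewrite (linZ lY) (linB lY) -scalerBr scalerA -expr2 sqr_sqrtr ?invr_ge0 ?ltW//.
  have -> : x - Y x - (Y x - Y (Y x)) = t *: A x.
    have := Ye x; rewrite -/Y scaler_nat mulr2n {1}/relax => h.
    apply: (addIr (Y x + Y x)); rewrite opprB addrACA !subrK h.
    by rewrite addrA (addrC (t *: _)) subrK.
  by rewrite scalerA mulVf ?gt_eqF// scale1r.
Qed.

(** * Strong limit of the powers of [1 - t A] *)

Section relaxation_powers.
Context {R : realType} {H : hilbertType R}.
Implicit Types (x y z : H).
Variables (A : H -> H) (t : R).
Hypotheses (bA : bounded_op A) (sA : self_adjoint A) (t0 : 0 < t).
Hypothesis tA : forall y, t * `|A y| ^+ 2 <= inner (A y) y.
Local Notation C := (relax t A).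

Lemma self_adjoint_iter (U : H -> H) n : self_adjoint U -> self_adjoint (iter n U).
Proof. by move=> sU; elim: n => // n IH x y; rewrite iterS sU IH -iterSr. Qed.

Lemma relax_bounded_op : bounded_op C.
Proof.
split; first exact: relax_linear.
by exists 1 => x; rewrite mul1r; exact: relax_contraction.
Qed.

Lemma iter_relax_contraction n x : `|iter n C x| <= `|x|.
Proof.
by elim: n => // n IH; rewrite iterS (le_trans (relax_contraction t0 tA _)).
Qed.

Lemma inner_iter_relax m n x :
  inner (iter n C x) (iter m C x) = inner (iter (m + n) C x) x.
Proof.
by rewrite iterD -(self_adjoint_iter m (relax_self_adjoint t sA)).
Qed.

(** Moving half of the factors across the inner product reduces even and odd [n] to
    [<C z, z> <= |z|^2] and [|C z|^2 <= <C z, z>] respectively, at [z = C^m x]. *)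
Lemma inner_iter_relax_homo x :
  {homo (fun n => - inner (iter n C x) x) : m n / (m <= n)%N >-> m <= n}.
Proof.
apply/nondecreasing_seqP => n; rewrite lerN2.
rewrite -(odd_double_half n) -addnn; set m := n./2.
have e0 : inner (iter (m + m) C x) x = `|iter m C x| ^+ 2.
  by rewrite -inner_iter_relax inner_normE.
have e1 : inner (iter (m + m).+1 C x) x = inner (C (iter m C x)) (iter m C x).
  by rewrite -addnS -inner_iter_relax.
have e2 : inner (iter (m + m).+2 C x) x = `|C (iter m C x)| ^+ 2.
  by rewrite -addnS -addSn -inner_iter_relax inner_normE.
case: (odd n); rewrite ?add0n ?add1n ?e0 e1 ?e2.
- exact: relax_sqnorm_le.
- exact: relax_inner_le.
Qed.

(** With [c_n = <C^n x, x>], the squared distance of [C^n x] and [C^m x] is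
    [c_{2n} - 2 c_{m+n} + c_{2m}], at most [c_{2m} - c_{2n}] because [c_{2n} <= c_{m+n}]. The
    sequence [c_{2n}] decreases and is nonnegative. *)
Lemma is_cvg_iter_relax x : cvgn (fun n => iter n C x).
Proof.
pose b n := - inner (iter (n + n) C x) x.
apply: (@is_cvg_sqnorm _ _ b 1).
  apply: nondecreasing_is_cvgn.
    by move=> m n mn; apply: inner_iter_relax_homo; exact: leq_add.
  exists 0 => _ [n _ <-].
  by rewrite /b -inner_iter_relax inner_normE oppr_le0 sqr_ge0.
move=> m n mn; rewrite mul1r sqnormB -!inner_normE !inner_iter_relax.
apply: le_trans (ler_norm _); rewrite /b.
have := @inner_iter_relax_homo x (m + n)%N (n + n)%N (leq_add mn (leqnn n)).
by rewrite lerN2; lra.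
Qed.

Definition relax_lim x : H := limn (fun n => iter n C x).

Lemma cvg_iter_relax x : (fun n => iter n C x) @ \oo --> relax_lim x.
Proof. exact: is_cvg_iter_relax. Qed.

Lemma relax_lim_self_adjoint : self_adjoint relax_lim.
Proof.
move=> x y; have h := @cvg_innerl _ _ _ _ y (@cvg_iter_relax x).
rewrite -(cvg_lim _ h)//; apply: cvg_lim => //.
rewrite innerC (_ : (fun n => _) = fun n => inner (iter n C y) x).
  exact: (@cvg_innerl _ _ _ _ x (@cvg_iter_relax y)).
apply/funext => n; rewrite innerC -self_adjoint_iter//.
exact: relax_self_adjoint.
Qed.

(** The limit is a fixed point of [C], and [C y = y] means [t A y = 0]. *)
Lemma op_relax_lim x : A (relax_lim x) = 0.
Proof.
have h1 := @cvg_op _ _ _ _ _ relax_bounded_op (@cvg_iter_relax x).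
have h2 : (fun n => iter n.+1 C x) @ \oo --> relax_lim x.
  by have := @cvg_iter_relax x; rewrite -cvg_shiftS.
have /eqP : C (relax_lim x) = relax_lim x.
  by apply: (cvg_unique _ h1 h2) => //; exact: norm_hausdorff.
rewrite /relax.
rewrite -subr_eq0 addrAC subrr add0r oppr_eq0 scaler_eq0 gt_eqF//=.
by move/eqP.
Qed.

(** The geometric sum [t (1 + C + ... + C^(n-1))], that is, [(1 - C^n) / A] as a polynomial in
    [A]. *)
Fixpoint relax_quot n : H -> H :=
  if n is n'.+1 then fun x => relax_quot n' x + t *: iter n' C x else fun=> 0.

Lemma op_relax_quot n x : A (relax_quot n x) = x - iter n C x.
Proof.
have [lA _] := bA.
elim: n => [|n IH]; first by rewrite /= lin0// subrr.
by rewrite /= linD// IH linZ// {2}/relax opprB addrA addrAC.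
Qed.

Lemma relax_quot_bounded_op n : bounded_op (relax_quot n).
Proof.
have lC := @relax_linear _ _ _ t bA.
elim: n => [|n [lq [M qM]]]; split.
- by move=> a x y; rewrite /= scaler0 addr0.
- by exists 0 => x /=; rewrite normr0 mul0r.
- move=> a x y /=; rewrite lq (lin_iter lC) !scalerDr addrACA !scalerA.
  by rewrite (mulrC a).
- exists (M + t) => x /=; rewrite (le_trans (ler_normD _ _))// mulrDl lerD//.
  by rewrite normrZ gtr0_norm// ler_pM2l// iter_relax_contraction.
Qed.

Lemma relax_quot_self_adjoint n : self_adjoint (relax_quot n).
Proof.
elim: n => [|n IH] x y /=; first by rewrite inner0l innerC inner0l.
rewrite innerDl innerDr IH innerZl innerZr self_adjoint_iter//.
exact: relax_self_adjoint.
Qed.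

(** Commutation with [A] passes to the powers of [C] and to their sums; it is used with [W] the
    square root of [A]. *)
Lemma relax_quot_comm (W : H -> H) n : linear W -> W \o A =1 A \o W ->
  W \o relax_quot n =1 relax_quot n \o W.
Proof.
move=> lW WA; have WC m : W \o iter m C =1 iter m C \o W.
  elim: m => // m IH x; rewrite /= {1}/relax linB// linZ//.
  by have /= -> := WA (iter m C x); have /= -> := IH x.
elim: n => [|n IH] x /=; first by rewrite lin0.
by rewrite linD// linZ//; have /= -> := IH x; have /= -> := WC n x.
Qed.

End relaxation_powers.

(** * Series of nonnegative terms *)

Section nneseries_facts.
Context {R : realType}.

Lemma nneseries_cvg (f : nat -> R) (l : R) : series f @ \oo --> l ->
  (\sum_(0 <= k <oo) (f k)%:E = l%:E)%E.
Proof.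
move=> fl; apply: cvg_lim => //.
rewrite (_ : (fun n => _) = EFin \o series f); last first.
  by apply/funext => n; rewrite /= /series/= sumEFin.
by apply: cvg_EFin; [near=> n|exact: fl].
Unshelve. all: by end_near. Qed.

Lemma nneseries_is_cvg (f : nat -> R) : (forall k, 0 <= f k) ->
  (\sum_(0 <= k <oo) (f k)%:E < +oo)%E -> cvgn (series f).
Proof.
move=> f0 foo; apply: nondecreasing_is_cvgn.
  by apply/nondecreasing_seqP => n; rewrite /series/= big_nat_recr//= lerDl.
exists (fine (\sum_(0 <= k <oo) (f k)%:E)) => _ [n _ <-].
rewrite -lee_fin fineK; last first.
  by rewrite ge0_fin_numE// nneseries_ge0// => k _ _; rewrite lee_fin.
rewrite /series/= -sumEFin; apply: nneseries_lim_ge => k _ _.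
by rewrite lee_fin.
Qed.

(** Dominated convergence for series: the tail of [g] beyond some [J] costs [e / 2] uniformly in
    [n], and the finitely many remaining terms tend to 0. *)
Lemma nneseries_dominated (f : nat -> nat -> R) (g : nat -> R) :
  (forall n j, 0 <= f n j <= g j) -> (\sum_(0 <= j <oo) (g j)%:E < +oo)%E ->
  (forall j, f ^~ j @ \oo --> (0 : R)) ->
  forall e : R, 0 < e ->
    \forall n \near \oo, (\sum_(0 <= j <oo) (f n j)%:E <= e%:E)%E.
Proof.
move=> fg goo f0 e e0.
have e20 : 0 < e / 2 by rewrite divr_gt0.
have g0 j : (0 <= (g j)%:E)%E.
  by rewrite lee_fin; have /andP[/le_trans h1 h2] := fg 0%N j; exact: h1.
have f00 n j : (0 <= (f n j)%:E)%E by rewrite lee_fin; have /andP[] := fg n j.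
have [J tailJ] : exists J, (\sum_(J <= j <oo) (g j)%:E <= (e / 2)%:E)%E.
  have := nneseries_tail_cvg goo (fun j _ => g0 j).
  move=> /fine_cvgP[fin /cvgrPdist_le /(_ _ e20)] h.
  near \oo => J; exists J.
  rewrite -[leLHS]fineK; last by near: J.
  rewrite lee_fin (le_trans (ler_norm _))//.
  rewrite -normrN -sub0r; near: J; exact: h.
have h : (fun n => \sum_(0 <= j < J) f n j) @ \oo --> (0 : R).
  elim: (index_iota 0 J) => [|j s IH].
    rewrite (_ : (fun n => _) = cst 0); first exact: cvg_cst.
    by apply/funext => n; rewrite big_nil.
  have -> : (fun n => \sum_(i <- j :: s) f n i) =
      (fun n => f n j + \sum_(i <- s) f n i).
    by apply/funext => n; rewrite big_cons.
  by rewrite -[X in _ --> X]addr0; apply: cvgD; [exact: f0|exact: IH].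
move/cvgrPdist_le : h => /(_ _ e20) h.
near=> n.
rewrite (@nneseries_split _ _ 0%N J)//.
rewrite [e]splitr EFinD add0n; apply: leeD.
  rewrite sumEFin lee_fin (le_trans (ler_norm _))// -normrN -sub0r.
  by near: n; exact: h.
apply: le_trans tailJ; apply: lee_nneseries => k //= _.
by rewrite lee_fin; have /andP[] := fg n k.
Unshelve. all: by end_near. Qed.

End nneseries_facts.

(** * Parseval's identity and adjoints of Hilbert-Schmidt operators *)

Section orthonormal_bases.
Context {R : realType} {H : hilbertType R}.
Implicit Types (x y z : H).
Variable e : nat -> H.
Hypothesis oe : orthonormal_basis e.

Lemma series_inner x y :
  series (fun k => inner x (e k) * inner y (e k)) @ \oo --> inner x y.
Proof.
have [_ ex] := oe; have := @cvg_innerl _ _ _ _ y (ex x).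
rewrite (_ : (fun n => _) = series (fun k => inner x (e k) * inner y (e k)))//.
apply/funext => n; rewrite /series/= inner_suml; apply: eq_bigr => k _.
by rewrite innerZl (innerC y).
Qed.

Lemma parseval x : (\sum_(0 <= k <oo) (inner x (e k) ^+ 2)%:E = (`|x| ^+ 2)%:E)%E.
Proof. by apply: nneseries_cvg; rewrite -inner_normE; exact: series_inner. Qed.

Lemma sqnorm_orthonormal_sum (c : nat -> R) m n :
  `|\sum_(m <= k < n) c k *: e k| ^+ 2 = \sum_(m <= k < n) c k ^+ 2.
Proof.
have [oe' _] := oe; elim: n => [|n IH].
  by rewrite !big_geq// normr0 expr0n.
have [nm|mn] := ltnP n m; first by rewrite !big_geq// normr0 expr0n.
rewrite !big_nat_recr//= sqnormD IH normrZ exprMn -inner_normE oe' eqxx mulr1.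
rewrite real_normK ?num_real//.
suff -> : inner (\sum_(m <= i < n) c i *: e i) (c n *: e n) = 0.
  by rewrite mulr0 addr0.
rewrite innerZr (_ : inner _ _ = 0) ?mulr0//.
rewrite inner_suml big_nat big1// => i /andP[_ ni].
by rewrite innerZl oe' ltn_eqF// mulr0.
Qed.

Variable S : H -> H.
Hypotheses (bS : bounded_op S)
  (HS : (\sum_(0 <= k <oo) (`|S (e k)| ^+ 2)%:E < +oo)%E).

(** The witness is [S^* y = sum_k <y, S e_k> e_k]: by Cauchy-Schwarz its coefficients are at most
    [|y| |S e_k|], and these are square-summable. *)
Lemma is_adjoint_adjoint : is_adjoint S (adjoint S).
Proof.
apply: xgetPex; have [lS _] := bS.
have cS := nneseries_is_cvg (fun k => sqr_ge0 `|S (e k)|) HS.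
pose s y := series (fun k => inner y (S (e k)) *: e k).
have cs y : cvgn (s y).
  apply: (is_cvg_sqnorm (K := `|y| ^+ 2) cS) => m n mn.
  rewrite /s !sub_series_geq// sqnorm_orthonormal_sum.
  rewrite ger0_norm ?sumr_ge0// mulr_sumr ler_sum// => k _.
  rewrite -exprMn -[leLHS]real_normK ?num_real//.
  by rewrite ler_sqr ?nnegrE ?mulr_ge0// cauchy_schwarz.
exists (fun y => limn (s y)) => x y.
have [_ ex] := oe.
have h1 := @cvg_innerl _ _ _ _ y (cvg_op bS (ex x)).
have h2 := @cvg_innerl _ _ _ _ x (cs y).
rewrite [RHS]innerC -(cvg_lim _ h1)// -(cvg_lim _ h2)//.
congr (limn _); apply/funext => n.
rewrite /s /series/= lin_sum// !inner_suml; apply: eq_bigr => k _.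
by rewrite linZ// !innerZl (innerC (e k)) (innerC (S _)) mulrC.
Qed.

(** Parseval in either variable shows that [S] and [S^*] lead to the same double sum of
    [<S e_k, e_j>^2], up to exchanging the sums. *)
Lemma hilbert_schmidt_adjoint :
  (\sum_(0 <= j <oo) (`|adjoint S (e j)| ^+ 2)%:E < +oo)%E.
Proof.
rewrite (eq_eseriesr
  (g := fun j => \sum_(0 <= k <oo) (inner (S (e k)) (e j) ^+ 2)%:E)%E).
  rewrite nneseries_interchange; last by move=> i j; rewrite lee_fin sqr_ge0.
  by under eq_eseriesr do rewrite parseval.
move=> j _; rewrite -parseval; apply: eq_eseriesr => k _.
by rewrite is_adjoint_adjoint innerC.
Qed.

End orthonormal_bases.

(** * Second moments of centered normal laws *)

Section normal_moment.
Context {R : realType}.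
Notation leb := (@lebesgue_measure R).

(** [normal_pdf] has the same integrals over measurable sets as the Radon-Nikodym derivative, hence
    equals it almost everywhere. *)
Lemma ge0_integral_normal_prob (m s : R) (f : R -> \bar R) :
  measurable_fun [set: R] f -> (forall x, 0 <= f x)%E ->
  (\int[normal_prob m s]_x f x = \int[leb]_x (f x * (normal_pdf m s x)%:E))%E.
Proof.
move=> mf f0.
have dom := normal_prob_dominates m s.
have mpdf : measurable_fun [set: R] (EFin \o normal_pdf m s).
  by apply/measurable_EFinP; exact: measurable_normal_pdf.
have RN := Radon_Nikodym_SigmaFinite.f_integrable dom.
rewrite -(Radon_Nikodym_SigmaFinite.change_of_variables dom)//.
apply: ae_eq_integral => //.
- by apply: emeasurable_funM => //; exact: measurable_int RN.
- exact: emeasurable_funM.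
- apply: ae_eqe_mul2l; apply: integral_ae_eq => // E _ mE.
  by rewrite -Radon_Nikodym_SigmaFinite.f_integral.
Qed.

(** Doubling the standard deviation absorbs the factor [x ^+ 2], so the second moment is bounded by
    the total mass of a wider normal density. The constant 8 is crude; only proportionality to the
    variance matters later. *)
Lemma sqr_normal_pdf_le (s x : R) : 0 < s ->
  x ^+ 2 * normal_pdf 0 s x <= 8 * s ^+ 2 * normal_pdf 0 (2 * s) x.
Proof.
move=> s0.
have s20 : 0 < s ^+ 2 by rewrite exprn_gt0.
rewrite !normal_pdfE ?gt_eqF ?mulr_gt0// /normal_fun.
have -> : normal_peak (2 * s) = normal_peak s / 2.
  rewrite /normal_peak exprMn -mulrA -mulrnAr sqrtrM ?sqr_ge0// sqrtr_sqr.
  by rewrite ger0_norm// invfM mulrC.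
(* With u = x^2 / (4 s^2), this is u e^(-2u) <= e^(-u) <= e^(-u/2). *)
rewrite subr0; pose u := x ^+ 2 / (s ^+ 2 *+ 2) / 2.
have -> : - x ^+ 2 / (s ^+ 2 *+ 2) = - u + - u.
  by rewrite /u !mulNr -opprD -splitr.
have -> : - x ^+ 2 / ((2 * s) ^+ 2 *+ 2) = - (u / 2).
  by rewrite /u; field; rewrite gt_eqF.
have -> : x ^+ 2 = 4 * s ^+ 2 * u by rewrite /u; field; rewrite gt_eqF.
have u0 : 0 <= u by rewrite /u !divr_ge0 ?sqr_ge0// mulrn_wge0// ltW.
rewrite expRD.
have h1 : u * expR (- u) <= 1.
  rewrite expRN ler_pdivrMr ?expR_gt0// mul1r.
  by rewrite (le_trans _ (expR_ge1Dx u))// lerDr.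
have h2 : expR (- u) <= expR (- (u / 2)) by rewrite ler_expR; lra.
have -> : 4 * s ^+ 2 * u * (normal_peak s * (expR (- u) * expR (- u))) =
  4 * s ^+ 2 * normal_peak s * (u * expR (- u) * expR (- u)) by ring.
have -> : 8 * s ^+ 2 * (normal_peak s / 2 * expR (- (u / 2))) =
  4 * s ^+ 2 * normal_peak s * expR (- (u / 2)) by field.
apply: ler_wpM2l; first by rewrite !mulr_ge0 ?normal_peak_ge0// ltW.
by rewrite (le_trans _ h2)// ler_piMl ?expR_ge0.
Qed.

Lemma normal_prob_second_moment_le (s : R) : 0 < s ->
  (\int[normal_prob 0 s]_x (x ^+ 2)%:E <= (8 * s ^+ 2)%:E)%E.
Proof.
move=> s0; rewrite ge0_integral_normal_prob//; last first.
- by move=> x; rewrite lee_fin sqr_ge0.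
- by apply/measurable_EFinP; exact: exprn_measurable.
have mpdf t : measurable_fun [set: R] (fun x => (normal_pdf 0 t x)%:E).
  by apply/measurable_EFinP; exact: measurable_normal_pdf.
apply: (@le_trans _ _
  (\int[leb]_x ((8 * s ^+ 2)%:E * (normal_pdf 0 (2 * s) x)%:E))%E).
  apply: ge0_le_integral => //.
  - by move=> x _; rewrite -EFinM lee_fin mulr_ge0 ?sqr_ge0// normal_pdf_ge0.
  - apply: emeasurable_funM; last exact: mpdf.
    by apply/measurable_EFinP; exact: exprn_measurable.
  - by apply: emeasurable_funM => //; exact: mpdf.
  - by move=> x _; rewrite -!EFinM lee_fin sqr_normal_pdf_le.
rewrite ge0_integralZl//.
- by rewrite integral_normal_pdf mule1.
- exact: mpdf.
- by move=> x _; rewrite lee_fin normal_pdf_ge0.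
- by rewrite lee_fin mulr_ge0// sqr_ge0.
Qed.

Lemma normal_law_second_moment_le d (T : measurableType d)
    (mu : {measure set T -> \bar R}) (f : T -> R) (v : R) :
  measurable_fun setT f -> 0 <= v ->
  (forall B : set R, measurable B -> mu (f @^-1` B) = normal_law v B) ->
  (\int[mu]_x (f x ^+ 2)%:E <= (8 * v)%:E)%E.
Proof.
move=> mf v0 muf.
have msqr : measurable_fun [set: R] (fun x : R => (x ^+ 2)%:E).
  by apply/measurable_EFinP; exact: exprn_measurable.
have mf' : measurable_fun setT (f : T -> measurableTypeR R) by exact: mf.
have -> : (\int[mu]_x (f x ^+ 2)%:E =
    \int[pushforward mu (f : T -> measurableTypeR R)]_x (x ^+ 2)%:E)%E.
  rewrite [RHS](ge0_integral_pushforward mf')// ?preimage_setT//.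
  by move=> y _; rewrite lee_fin sqr_ge0.
have [v00|v00] := eqVneq v 0.
  rewrite (@eq_measure_integral _ _ _ _ (\d_(0 : measurableTypeR R))); last first.
    by move=> B mB _; rewrite /pushforward [LHS]muf// /normal_law v00 eqxx.
  by rewrite integral_dirac// expr0n mule0 lee_fin mulr_ge0.
have -> : (\int[pushforward mu (f : T -> measurableTypeR R)]_x (x ^+ 2)%:E =
    \int[normal_prob 0 (Num.sqrt v)]_x (x ^+ 2)%:E)%E.
  apply: eq_measure_integral => B mB _.
  by rewrite /pushforward [LHS]muf// /normal_law (negbTE v00).
rewrite (le_trans (normal_prob_second_moment_le _))//.
  by rewrite sqrtr_gt0 lt_neqAle eq_sym v00.
by rewrite sqr_sqrtr.
Qed.

End normal_moment.

(** * Almost sure limits of variables with a common law *)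

Section limit_law.
Context d (T : measurableType d) {R : realType} (mu : probability T R).

(** Fatou's lemma for sets: on [G], [E] lies in the increasing union of the tail intersections
    [B N], each of measure at most [c] since it is contained in [F N]. *)
Lemma measure_le_eventually (c : \bar R) (G E : set T) (F : nat -> set T) :
  measurable G -> mu (~` G) = 0%E -> measurable E ->
  (forall n, measurable (F n)) -> (forall n, mu (F n) <= c)%E ->
  (forall x, G x -> E x -> \forall n \near \oo, F n x) -> (mu E <= c)%E.
Proof.
move=> mG G0 mE mF Fc EF.
pose B N := \bigcap_(n in [set n | (N <= n)%N]) F n.
have mB N : measurable (B N).
  by apply: bigcap_measurable => [|k _]; [exists N => /=|exact: mF].
have BB : {homo B : n m / (n <= m)%N >-> (n <= m)%O}.
  move=> n m nm; apply/subsetPset => x Bx k /= mk.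
  by apply: Bx => /=; exact: leq_trans mk.
have mUB : measurable (\bigcup_N B N) by exact: bigcupT_measurable.
have UBc : (mu (\bigcup_N B N) <= c)%E.
  have h : mu \o B @ \oo --> mu (\bigcup_N B N) by exact: nondecreasing_cvg_mu.
  rewrite -(cvg_lim _ h)//; apply: lime_le; first by apply/cvg_ex; eexists; exact: h.
  near=> N; rewrite (le_trans _ (Fc N))//.
  by apply: le_measure; rewrite ?inE// => x; apply; exact: leqnn.
apply: (@le_trans _ _ (mu (\bigcup_N B N `|` ~` G))).
  apply: le_measure; rewrite ?inE//.
    by apply: measurableU => //; exact: measurableC.
  move=> x Ex; have [Gx|] := pselect (G x); last by right.
  by left; have [N _ FN] := EF _ Gx Ex; exists N.
apply: le_trans (measureU2 _ _ _) _ => //; first exact: measurableC.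
by rewrite [X in (_ + X)%E]G0 adde0.
Unshelve. all: by end_near. Qed.

(** Convergence gives upper bounds on open rays. Complements of left rays bound closed right rays
    from below, and these exhaust the open right rays; so both measures agree on a generating family
    stable under intersection. *)
Lemma limit_law (nu : probability (measurableTypeR R) R) (G : set T)
    (f : T -> R) (g : nat -> T -> R) :
  measurable G -> mu (~` G) = 0%E -> measurable_fun setT f ->
  (forall n, measurable_fun setT (g n)) ->
  (forall x, G x -> g ^~ x @ \oo --> f x) ->
  (forall n (B : set R), measurable B -> mu (g n @^-1` B) = nu B) ->
  forall B : set R, measurable B -> mu (f @^-1` B) = nu B.
Proof.
move=> mG G0 mf mg gf gnu.
have mpre (h : T -> R) (B : set R) : measurable_fun setT h -> measurable B ->
    measurable (h @^-1` B).
  by move=> mh mB; rewrite -[X in measurable X]setTI; exact: mh.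
have lt_le t : (mu (f @^-1` `]-oo, t[%classic) <= nu `]-oo, t[%classic)%E.
  apply: (@measure_le_eventually _ G _ (fun n => g n @^-1` `]-oo, t[%classic)) => //.
  - exact: mpre.
  - by move=> n; exact: mpre.
  - by move=> n; rewrite gnu.
  - move=> x Gx; rewrite /= in_itv/= => ft.
    near=> n; rewrite in_itv/=; near: n.
    exact: (cvgr_lt _ (gf _ Gx)).
have gt_le t : (mu (f @^-1` `]t, +oo[%classic) <= nu `]t, +oo[%classic)%E.
  apply: (@measure_le_eventually _ G _ (fun n => g n @^-1` `]t, +oo[%classic)) => //.
  - exact: mpre.
  - by move=> n; exact: mpre.
  - by move=> n; rewrite gnu.
  - move=> x Gx; rewrite /= in_itv/= andbT => ft.
    near=> n; rewrite in_itv/= andbT; near: n.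
    exact: (cvgr_gt _ (gf _ Gx)).
have ge_le t : (nu `[t, +oo[%classic <= mu (f @^-1` `[t, +oo[%classic))%E.
  have -> : nu `[t, +oo[%classic = (1 - nu `]-oo, t[%classic)%E.
    by rewrite -setCitvl probability_setC.
  have -> : mu (f @^-1` `[t, +oo[%classic) = (1 - mu (f @^-1` `]-oo, t[%classic))%E.
    rewrite -setCitvl preimage_setC probability_setC//.
    exact: (mpre f `]-oo, t[%classic).
  by apply: leeB => //; exact: lt_le.
have rayE t : mu (f @^-1` `]t, +oo[%classic) = nu `]t, +oo[%classic.
  apply/eqP; rewrite eq_le gt_le/=.
  pose F k := `[t + k.+1%:R^-1, +oo[%classic : set R.
  have mF k : measurable (F k) by exact: measurable_itv.
  have FE : \bigcup_k F k = `]t, +oo[%classic by rewrite itvoyEbigcup.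
  have FF : {homo F : n m / (n <= m)%N >-> (n <= m)%O}.
    move=> n m nm; apply/subsetPset; apply: subset_itvr.
    by rewrite bnd_simp lerD2l lef_pV2 ?posrE// ler_nat.
  have h : nu \o F @ \oo --> nu (\bigcup_k F k).
    by apply: nondecreasing_cvg_mu => //; exact: bigcupT_measurable.
  suff : (nu (\bigcup_k F k) <= mu (f @^-1` `]t, +oo[%classic))%E by rewrite FE.
  rewrite -(cvg_lim _ h)//; apply: lime_le.
    by apply/cvg_ex; eexists; exact: h.
  near=> k; rewrite (le_trans (ge_le _))//; apply: le_measure; rewrite ?inE.
  - exact: mpre.
  - exact: (mpre f `]t, +oo[%classic).
  - by move=> x; apply: subset_itvr; rewrite bnd_simp ltrDl.
have mf' : measurable_fun setT (f : T -> measurableTypeR R) by exact: mf.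
pose fmu : {measure set (measurableTypeR R) -> \bar R} :=
  pushforward mu (f : T -> measurableTypeR R).
suff h (B : set (measurableTypeR R)) : measurable B -> fmu mf' B = nu B by exact: h.
apply: (@measure_unique _ _ (measurableTypeR R) (@RGenOInfty.G R)
  (fun n => `](- n%:R), +oo[%classic) _ _ _ _ (fmu mf') nu) => //.
- exact: RGenOInfty.measurableE.
- move=> _ _ [x ->] [y ->]; exists (Num.max x y).
  by apply/seteqP; split=> z /=; rewrite !in_itv/= !andbT gt_max => /andP.
- by move=> n; eexists.
- apply/seteqP; split=> // x _.
  exists (Num.bound (- x)) => //=; rewrite in_itv/= andbT ltrNl.
  exact: unstable.ltr_bound.
- by move=> _ [x ->]; exact: rayE.
- by move=> k; rewrite [ltLHS]rayE (le_lt_trans (probability_le1 _ _))// ltry.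
Unshelve. all: by end_near. Qed.

End limit_law.

(** * Borel maps into the Hilbert space *)

Section borel_measurability.
Context {R : realType} {H : hilbertType R}.

Lemma measurable_fun_borel d (T : measurableType d) (f : T -> borelType H) :
  (forall U : set H, open U -> measurable (f @^-1` U)) -> measurable_fun setT f.
Proof.
move=> fU.
apply: (@measurability _ _ T (borelType H) setT f (@open H) erefl) => _ [U oU <-].
by rewrite setTI; exact: fU.
Qed.

Lemma continuous_measurable_borel (f : H -> R) : continuous f ->
  measurable_fun setT (f : borelType H -> R).
Proof.
move=> cf; apply: (@measurability _ _ (borelType H) (measurableTypeR R) setT f _
  (RGenOInfty.measurableE R)) => _ [_ [x ->] <-].
rewrite setTI; apply: sub_sigma_algebra; apply: open_comp => //.
Qed.

Lemma measurable_fun_innerl (h : H) :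
  measurable_fun setT ((fun x => inner x h) : borelType H -> R).
Proof. by apply: continuous_measurable_borel; exact: innerl_continuous. Qed.

Lemma continuous_sqnorm (f : H -> H) : continuous f ->
  continuous (fun x => `|f x| ^+ 2 : R).
Proof.
move=> cf x; have nf : {for x, continuous (fun x => `|f x| : R)}.
  by apply: continuous_comp; [exact: cf|exact: norm_continuous].
exact: (@continuousM _ _ (fun x => `|f x| : R) (fun x => `|f x| : R)).
Qed.

(** An open set is exhausted by closed sets at positive distance from its complement, and the limit
    lies in it exactly when some tail of the sequence stays in one of them. Off [G] the constant
    value settles the question. *)
Lemma measurable_fun_borel_lim d (T : measurableType d)
    (f : nat -> T -> H) (g : T -> H) (G : set T) (c : H) :
  measurable G -> (forall n (U : set H), open U -> measurable (f n @^-1` U)) ->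
  (forall x, G x -> f ^~ x @ \oo --> g x) -> (forall x, ~ G x -> g x = c) ->
  measurable_fun setT (g : T -> borelType H).
Proof.
move=> mG mf fg gc; apply: measurable_fun_borel => U oU.
(* [~` V k] is the set of points at distance at least 1/(k+1) from [~` U]. *)
pose V k := \bigcup_(y in ~` U) ball y (k.+1%:R^-1 : R).
have oV k : open (V k) by apply: bigcup_open => y _; exact: ball_open.
pose E := \bigcup_k \bigcup_N
  \bigcap_(n in [set n | (N <= n)%N]) (f n @^-1` (~` V k)).
have mE : measurable E.
  apply: bigcupT_measurable => k; apply: bigcupT_measurable => N.
  apply: bigcap_measurable => [|n _]; first by exists N => /=.
  by rewrite preimage_setC; apply: measurableC; exact: (mf n (V k) (oV k)).
have -> : g @^-1` U = (G `&` E) `|` (~` G `&` [set _ | U c]).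
  apply/seteqP; split=> [x Ugx|x].
  - have [Gx|nGx] := pselect (G x); last by right; split; rewrite //= -(gc _ nGx).
    left; split=> //.
    have /nbhs_ballP[e /= e0 eU] : nbhs (g x) U by exact: open_nbhs_nbhs.
    have e20 : 0 < e / 2 by rewrite divr_gt0.
    have [k kl] : exists k, k.+1%:R^-1 < e / 2.
      by exists (Num.truncn (e / 2)^-1); rewrite invf_plt ?posrE// truncnS_gt.
    have /cvgrPdist_lt /(_ _ e20) [N _ fN] := fg _ Gx.
    exists k => //; exists N => // n Nn [y nUy] yf; apply: nUy; apply: eU.
    apply: (@ball_split _ _ (f n x)).
      rewrite -ball_normE /=; exact: fN.
    apply: le_ball (ltW kl) _ _; exact: ball_sym.
  - case=> [[Gx [k _ [N _ fV]]]|[nGx /= Uc]]; last by rewrite /= gc.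
    apply: contrapT => nU.
    have k0 : (0 : R) < k.+1%:R^-1 by rewrite invr_gt0.
    have /cvgrPdist_lt /(_ _ k0) [M _ fM] := fg _ Gx.
    apply: (fV (maxn N M)); first by rewrite /= leq_maxl.
    exists (g x) => //; rewrite -ball_normE /=.
    by apply: fM; rewrite /= leq_maxr.
apply: measurableU; first exact: measurableI.
apply: measurableI; first exact: measurableC.
have [Uc|nUc] := pselect (U c).
  by rewrite (_ : [set _ | _] = setT)//; apply/seteqP; split.
by rewrite (_ : [set _ | _] = set0)//; apply/seteqP; split.
Qed.

End borel_measurability.

(** * Second moments under a Gaussian measure *)

Section gaussian_moments.
Context {R : realType} {H : hilbertType R}.
Variables (A : H -> H) (mu : probability (borelType H) R).
Hypotheses (pA : psd A) (gmu : gaussian A mu).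

Lemma gaussian_sqr_inner_le (h : H) :
  (\int[mu]_x (inner (x : H) h ^+ 2)%:E <= (8 * inner (A h) h)%:E)%E.
Proof.
apply: normal_law_second_moment_le; first exact: measurable_fun_innerl.
  exact: pA.
by move=> B mB; exact: gmu.
Qed.

(** Here [g j] stands for [L^* e_j], so each coordinate of [L x] is a Gaussian functional of [x];
    Parseval and an exchange of sum and integral do the rest. *)
Lemma gaussian_sqnorm_le (e : nat -> H) (L : H -> H) (g : nat -> H) :
  orthonormal_basis e -> (forall x j, inner (L x) (e j) = inner x (g j)) ->
  (\int[mu]_x (`|L x| ^+ 2)%:E <=
   \sum_(0 <= j <oo) (8 * inner (A (g j)) (g j))%:E)%E.
Proof.
move=> oe Lg.
under eq_integral => x _.
  rewrite -(parseval oe (L x)).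
  under eq_eseriesr => j _ do rewrite Lg.
  over.
rewrite integral_nneseries//.
- by apply: lee_nneseries => j _; [move=> _; apply: integral_ge0 => x _;
    rewrite lee_fin sqr_ge0|exact: gaussian_sqr_inner_le].
- move=> j; apply/measurable_EFinP; apply: measurable_funX.
  exact: measurable_fun_innerl.
- by move=> j x _; rewrite lee_fin sqr_ge0.
Qed.

End gaussian_moments.

(** * A summability criterion for convergence *)

Section summable_increments.
Context {R : realType}.

Lemma half_expn_series : (\sum_(0 <= k <oo) ((2^-1 ^+ k : R))%:E < +oo)%E.
Proof.
have h : series (fun k => 2^-1 ^+ k : R) @ \oo --> (1 * (1 - 2^-1)^-1 : R).
  have -> : (fun k => 2^-1 ^+ k : R) = geometric (1 : R) 2^-1.
    by apply/funext => k /=; rewrite mul1r.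
  by apply: cvg_geometric_series; rewrite ger0_norm ?invr_ge0// invf_lt1// ltr1n.
by rewrite (nneseries_cvg h) ltry.
Qed.

(** The weights [2^k] upgrade square-summable increments to absolutely summable ones. *)
Lemma is_cvg_weighted_increments (V : completeNormedModType R) (u : nat -> V) :
  (\sum_(0 <= k <oo) (2 ^+ k * `|u k.+1 - u k| ^+ 2)%:E < +oo)%E -> cvgn u.
Proof.
move=> foo.
have f0 k : 0 <= 2 ^+ k * `|u k.+1 - u k| ^+ 2 by rewrite mulr_ge0 ?exprn_ge0.
have c1 := nneseries_is_cvg f0 foo.
have c2 : cvgn (series (fun k => 2^-1 ^+ k : R)).
  by apply: nneseries_is_cvg half_expn_series => k; rewrite exprn_ge0 ?invr_ge0.
have c3 : cvgn [normed series (fun k => u k.+1 - u k)].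
  apply: (@series_le_cvg _ _ (fun k => 2^-1 ^+ k + 2 ^+ k * `|u k.+1 - u k| ^+ 2)).
  - by move=> k; rewrite normr_ge0.
  - by move=> k; rewrite addr_ge0 ?exprn_ge0 ?invr_ge0.
  - (* AM-GM: x <= 2^-k + 2^k x^2 *)
    move=> k /=; set x := `|_|; rewrite exprVn; set a := 2 ^+ k.
    have a0 : 0 < a by rewrite exprn_gt0.
    rewrite -(ler_pM2l a0) mulrDr mulfV ?gt_eqF//.
    have -> : a * (a * x ^+ 2) = (a * x) ^+ 2 by ring.
    have z0 : 0 <= a * x by apply: mulr_ge0; [exact: ltW|exact: normr_ge0].
    by have := sqr_ge0 (a * x - 1); rewrite sqrrB1; lra.
  - have -> : series (fun k => 2^-1 ^+ k + 2 ^+ k * `|u k.+1 - u k| ^+ 2) =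
        series (fun k => 2^-1 ^+ k : R) +
        series (fun k => 2 ^+ k * `|u k.+1 - u k| ^+ 2).
      by apply/funext => n; rewrite /series/= big_split.
    exact: is_cvgD c2 c1.
have := normed_cvg c3.
rewrite (_ : series _ = (fun n => u n - u 0%N)); last first.
  by apply/funext => n; rewrite /series/= telescope_sumr.
move=> /cvg_ex[/= l ul]; apply/cvg_ex; exists (l + u 0%N).
have : (fun n => (u n - u 0%N) + u 0%N) @ \oo --> l + u 0%N.
  by apply: cvgD; [exact: ul|exact: cvg_cst].
by rewrite (_ : (fun n => _) = u)//; apply/funext => n; rewrite subrK.
Qed.

End summable_increments.

(** * Image of a Gaussian measure under the closure of [T] *)

Section gaussian_image.
Context {R : realType} {H : hilbertType R}.
Variables (A : H -> H) (mu : probability (borelType H) R).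
Hypotheses (bA : bounded_op A) (sA : self_adjoint A) (pA : psd A).
Hypothesis gmu : gaussian A mu.
Variable T : partial_op H.
Hypothesis domT : range (sqrt_op A) `<=` dom T.
Let B := sqrt_op A.
Let S := T \o B.
Hypothesis HS : hilbert_schmidt S.

(** Stated on [H] itself, with [mu] the law of the random variable, so that composing [y] with that
    variable yields the Borel version sought. Closability later identifies [closure (graph T)] with
    a graph. *)
Lemma gaussian_closable_image :
  exists (y : H -> H) (G : set (borelType H)),
    [/\ measurable_fun setT (y : borelType H -> borelType H),
        measurable G, mu (~` G) = 0%E,
        (forall x, G x -> closure (graph T) (x, y x)) &
        forall (h : H) (D : set R), measurable D ->
          mu ((fun x => inner (y x) h) @^-1` D) =
          normal_law (inner (S (adjoint S h)) h) D].
Proof.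
have [bB sB pB BB] : is_sqrt_op A B := is_sqrt_sqrt_op bA sA pA.
have [lB _] := bB.
have BBE x : B (B x) = A x by rewrite -BB.
have [bS [e oe Soo]] := HS.
have [lS _] := bS; have [lA _] := bA.
have adjS : is_adjoint S (adjoint S) := is_adjoint_adjoint oe bS Soo.
have [t t0 tA] := psd_sqnorm_le bA sA pA.
pose C := relax t A; pose Q := relax_lim A t; pose q := relax_quot A t.
have CQ x : (fun n => iter n C x) @ \oo --> Q x :=
  @cvg_iter_relax _ _ _ _ sA t0 tA x.
have sQ : self_adjoint Q := relax_lim_self_adjoint sA t0 tA.
have AQ x : A (Q x) = 0 := op_relax_lim bA sA t0 tA x.
have Aq n x : A (q n x) = x - iter n C x := op_relax_quot t bA n x.
have bq n : bounded_op (q n) := relax_quot_bounded_op bA t0 tA n.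
have sq n : self_adjoint (q n) := relax_quot_self_adjoint t sA n.
have Bq n x : B (q n x) = q n (B x).
  by apply: (relax_quot_comm t n lB) => z; rewrite /= -!BBE.
(* From [A Q = 0] follows [|B Q z|^2 = <Q z, A Q z> = 0], hence [S Q = 0]; taking adjoints gives
   [Q S^* = 0]. *)
have QS h : Q (adjoint S h) = 0.
  apply: inner_ext => z; rewrite inner0l sQ innerC -adjS.
  have BQ0 : B (Q z) = 0.
    apply/eqP; rewrite -normr_eq0 -sqrf_eq0 -inner_normE sB BBE AQ.
    by rewrite innerC inner0l.
  have -> : S (Q z) = S 0 by rewrite /S /= BQ0 (lin0 lB).
  by rewrite (lin0 lS) inner0l.
pose s n := S \o B \o q n.
have bs n : bounded_op (s n).
  by apply: bounded_op_comp => //; exact: bounded_op_comp.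
have graphs n x : graph T (x - iter n C x, s n x).
  split=> /=; first by apply: domT; exists (B (q n x)) => //; rewrite -Aq -BBE.
  by rewrite -Aq -BBE.
have inners n x h : inner (s n x) h = inner x (q n (B (adjoint S h))).
  by rewrite /s /= adjS sB sq.
have innerA g : inner (A g) g = `|B g| ^+ 2 by rewrite -BBE sB inner_normE.
(* By [inners] and [innerA], the norm of this vector is the standard deviation of [<s n x, h>] under
   [mu]. *)
have Bqn n h : B (q n (B (adjoint S h))) = adjoint S h - iter n C (adjoint S h).
  by rewrite -Bq BBE Aq.
(* [r n] is the squared Hilbert-Schmidt norm of C^n S^*. *)
pose r n := (\sum_(0 <= j <oo) (`|iter n C (adjoint S (e j))| ^+ 2)%:E)%E.
have r_small (eps : R) : 0 < eps -> \forall n \near \oo, (r n <= eps%:E)%E.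
  move=> eps0.
  apply: (nneseries_dominated (g := fun j => `|adjoint S (e j)| ^+ 2)) => //.
  - move=> n j; rewrite sqr_ge0/= ler_sqr ?nnegrE//.
    exact: iter_relax_contraction.
  - exact: hilbert_schmidt_adjoint.
  - move=> j; have := CQ (adjoint S (e j)); rewrite QS => h.
    have h' : (fun n => `|iter n C (adjoint S (e j))|) @ \oo --> (0 : R).
      by rewrite -(@normr0 _ H); apply: cvg_norm.
    rewrite -(@mulr0 R 0); under eq_fun do rewrite expr2.
    exact: cvgM.
(* The constant is 8, from the Gaussian second moment, times 2, from [sqnormB_le]. *)
have diff_le m n : (\int[mu]_x (`|s n x - s m x| ^+ 2)%:E <=
    16%:E * (r m + r n))%E.
  apply: (le_trans (@gaussian_sqnorm_le _ _ A mu pA gmu e (fun x => s n x - s m x)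
    (fun j => q n (B (adjoint S (e j))) - q m (B (adjoint S (e j)))) oe _)).
    by move=> x j; rewrite innerBl !inners innerBr.
  rewrite -nneseriesD; [|by move=> j _ _; rewrite lee_fin sqr_ge0..].
  rewrite -nneseriesZl; last by move=> j _; rewrite -EFinD lee_fin addr_ge0 ?sqr_ge0.
  apply: lee_nneseries => j _.
    by move=> _; rewrite lee_fin mulr_ge0//; exact: pA.
  rewrite innerA linB// !Bqn opprB addrC addrA subrK -EFinD -EFinM lee_fin.
  have := sqnormB_le (iter m C (adjoint S (e j))) (iter n C (adjoint S (e j))).
  by rewrite addrC; lra.
(* The rate [4^-k] beats the weight [2^k] of [w] and leaves a summable [2^-k]. The bound [k <= nk k]
   sends the indices to infinity, whether or not they increase. *)
have [nk nkP] : exists nk : nat -> nat, forall k,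
    (k <= nk k)%N /\ (r (nk k) <= (4^-1 ^+ k)%:E)%E.
  suff /choice[nk nkP] : forall k, exists n, (k <= n)%N /\ (r n <= (4^-1 ^+ k)%:E)%E.
    by exists nk.
  move=> k.
  have [|N _ rN] := r_small (4^-1 ^+ k); first by rewrite exprn_gt0// invr_gt0.
  exists (maxn k N); split; first exact: leq_maxl.
  by apply: rN; rewrite /= leq_maxr.
have nkoo : nk @ \oo --> \oo.
  move=> P [N _ NP]; exists N => // k /= Nk; apply: NP => /=.
  by rewrite (leq_trans Nk)//; have [] := nkP k.
pose w k x := 2 ^+ k * `|s (nk k.+1) x - s (nk k) x| ^+ 2.
have w0 k x : 0 <= w k x by rewrite mulr_ge0 ?exprn_ge0 ?sqr_ge0.
have mw k : measurable_fun setT ((fun x => (w k x)%:E) : borelType H -> \bar R).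
  apply/measurable_EFinP; apply: measurable_funM => //.
  apply: continuous_measurable_borel; apply: continuous_sqnorm => x.
  by apply: continuousB; exact: bounded_op_continuous.
pose W := fun x : borelType H => (\sum_(0 <= k <oo) (w k x)%:E)%E.
have mW : measurable_fun setT W.
  by apply: ge0_emeasurable_sum => //; move=> k x _ _; rewrite lee_fin.
have W0 x : (0 <= W x)%E by apply: nneseries_ge0 => k _ _; rewrite lee_fin.
have intW : (\int[mu]_x W x < +oo)%E.
  rewrite integral_nneseries//; last by move=> k x _; rewrite lee_fin.
  (* 32 is 16 doubled, since [r (nk k)] and [r (nk k.+1)] are both at most [4^-k]. *)
  apply: (@le_lt_trans _ _ (\sum_(0 <= k <oo) (32%:E * (2^-1 ^+ k : R)%:E))%E).
    apply: lee_nneseries => k _.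
      by move=> _; apply: integral_ge0 => x _; rewrite lee_fin.
    rewrite /w; under eq_integral do rewrite EFinM.
    rewrite ge0_integralZl//; last first.
      apply/measurable_EFinP.
      apply: continuous_measurable_borel; apply: continuous_sqnorm => x.
      by apply: continuousB; exact: bounded_op_continuous.
    have [_ rk] := nkP k; have [_ rk1] := nkP k.+1.
    apply: (@le_trans _ _
      ((2 ^+ k)%:E * (16%:E * ((4^-1 ^+ k)%:E + (4^-1 ^+ k)%:E)))%E).
      apply: lee_wpmul2l; first by rewrite lee_fin exprn_ge0.
      apply: (le_trans (diff_le _ _)); apply: lee_wpmul2l; first by rewrite lee_fin.
      apply: leeD => //; apply: (le_trans rk1); rewrite lee_fin exprS.
      by rewrite ler_piMl ?exprn_ge0// invf_le1// ler1n.
    rewrite -EFinD -!EFinM lee_fin.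
    have -> : 4^-1 ^+ k = 2^-1 ^+ k * 2^-1 ^+ k :> R.
      by rewrite -exprMn -invfM -natrM.
    have -> : 2 ^+ k * (16 * (2^-1 ^+ k * 2^-1 ^+ k + 2^-1 ^+ k * 2^-1 ^+ k)) =
        (2 ^+ k * 2^-1 ^+ k) * (32 * 2^-1 ^+ k) :> R by ring.
    by rewrite -exprMn mulfV// expr1n mul1r.
  rewrite nneseriesZl; last by move=> k _; rewrite lee_fin exprn_ge0.
  by rewrite lte_mul_pinfty// half_expn_series.
(* On [G0] the subsequence [s (nk k) x] converges; the finite integral of [W] makes its complement
   null. *)
pose G0 := [set x : borelType H | (W x < +oo)%E].
have mG0 : measurable G0.
  by rewrite -[G0]setTI; apply: emeasurable_fun_infty_o.
have G00 : mu (~` G0) = 0%E.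
  have iW : mu.-integrable setT W.
    apply/integrableP; split=> //.
    by under eq_integral do rewrite gee0_abs//.
  have /measure_negligible : mu.-negligible (~` G0).
    apply: negligibleS (integrable_ae measurableT iW) => x /= nGx /(_ I).
    by rewrite ge0_fin_numE.
  by apply; exact: measurableC.
(* [G1] is the kernel of [Q], tested on the basis. Each [<x, Q e_j>] has variance
   [<A Q e_j, Q e_j> = 0], so its law is the Dirac mass at 0. *)
pose G1 := \bigcap_j [set x : borelType H | inner (x : H) (Q (e j)) = 0].
have mG1j j : measurable [set x : borelType H | inner (x : H) (Q (e j)) = 0].
  rewrite (_ : [set _ | _] =
    setT `&` (fun x : H => inner x (Q (e j))) @^-1` [set 0]).
    exact: measurable_fun_innerl.
  by rewrite setTI.
have mG1j0 j : mu (~` [set x : borelType H | inner (x : H) (Q (e j)) = 0]) = 0%E.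
  rewrite probability_setC//.
  have -> : mu [set x : borelType H | inner (x : H) (Q (e j)) = 0] = 1%E.
    transitivity (normal_law (inner (A (Q (e j))) (Q (e j))) [set (0:R)]).
      by rewrite -gmu.
    by rewrite AQ inner0l /normal_law eqxx diracE mem_set.
  by rewrite subee.
have mG1 : measurable G1 by exact: bigcapT_measurable.
have G10 : mu (~` G1) = 0%E.
  have /measure_negligible : mu.-negligible (~` G1).
    rewrite setC_bigcap; apply: negligible_bigcup => j.
    exact/(negligibleP _ (measurableC (mG1j j)))/mG1j0.
  by apply; exact: measurableC.
pose G := G0 `&` G1.
have mG : measurable G by exact: measurableI.
have Gc0 : mu (~` G) = 0%E.
  apply/eqP; rewrite eq_le measure_ge0 andbT setCI.
  apply: le_trans (measureU2 _ _ _) _; [exact: measurableC..|].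
  by rewrite [X in (X + _)%E]G00 [X in (_ + X)%E]G10 adde0.
(* The default value 0 off the measurable set [G] keeps [y] Borel. *)
pose y x : H := if pselect (G x) then limn (fun k => s (nk k) x) else 0.
have cy x : G x -> (fun k => s (nk k) x) @ \oo --> y x.
  move=> Gx; rewrite /y; case: pselect => [?|/(_ Gx)//].
  by have [G0x _] := Gx; exact: is_cvg_weighted_increments.
have ynG x : ~ G x -> y x = 0 by move=> nGx; rewrite /y; case: pselect.
have my : measurable_fun setT (y : borelType H -> borelType H).
  apply: (@measurable_fun_borel_lim _ _ _ (borelType H)
    (fun k => s (nk k)) y G 0) => //.
  move=> n U oU; apply: sub_sigma_algebra; apply: open_comp => // x _.
  exact: bounded_op_continuous.
exists y, G; split=> //.
- move=> x Gx.
  have Qx0 : Q x = 0.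
    apply/eqP; rewrite -normr_eq0 -sqrf_eq0 -eqe -(parseval oe) eseries0//.
    by move=> j _ _; rewrite sQ; have [_ /(_ j I) ->] := Gx; rewrite expr0n.
  have cx : (fun k => (x : H) - iter (nk k) C x) @ \oo --> (x : H).
    rewrite -[X in _ --> X]subr0; apply: cvgB; first exact: cvg_cst.
    by rewrite -Qx0; exact: (cvg_comp _ _ nkoo (CQ x)).
  apply: (@closed_cvg _ _ \oo _ (fun k => ((x : H) - iter (nk k) C x, s (nk k) x))
    (closure (graph T))).
  - exact: closed_closure.
  - by near=> k; apply: subset_closure; exact: graphs.
  - by apply: cvg_pair; [exact: cx|exact: cy].
- move=> h D mD; rewrite adjS inner_normE.
  (* If [S^* h = 0], the variance vanishes and no rescaling is possible; then every [<s n x, h>] is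
     0, and [<y x, h>] is identically 0. *)
  have [v0|v0] := eqVneq (adjoint S h) 0.
    have inner0 x : inner (y x) h = 0.
      have [Gx|nGx] := pselect (G x); last by rewrite ynG// inner0l.
      have hc := @cvg_innerl _ _ _ _ h (cy _ Gx).
      rewrite -(cvg_lim _ hc)//; apply: cvg_lim => //.
      under eq_fun do rewrite inners v0 (lin0 lB) (lin0 (bq _).1) innerC inner0l.
      exact: cvg_cst.
    have [D0|nD0] := pselect (D 0).
      rewrite v0 normr0 expr0n /normal_law eqxx diracE mem_set//.
      rewrite (_ : _ @^-1` _ = setT) ?probability_setT//.
      by apply/seteqP; split=> // x _ /=; rewrite inner0.
    rewrite v0 normr0 expr0n /normal_law eqxx diracE memNset//.
    rewrite (_ : _ @^-1` _ = set0) ?measure0//.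
    by apply/seteqP; split=> // x /=; rewrite inner0.
  pose v := `|adjoint S h| ^+ 2; have vgt0 : 0 < v by rewrite exprn_gt0 ?normr_gt0.
  rewrite /normal_law -/v gt_eqF//.
  pose g k := q (nk k) (B (adjoint S h)); pose vk k := `|B (g k)| ^+ 2.
  have cvk : vk @ \oo --> v.
    have h1 : (fun k => B (g k)) @ \oo --> adjoint S h.
      rewrite (_ : (fun k => _) =
        (fun k => adjoint S h - iter (nk k) C (adjoint S h))).
        rewrite -[X in _ --> X]subr0; apply: cvgB; first exact: cvg_cst.
        by rewrite -(QS h); exact: (cvg_comp _ _ nkoo (CQ (adjoint S h))).
      by apply/funext => k; rewrite Bqn.
    have h2 : (fun k => `|B (g k)|) @ \oo --> `|adjoint S h| by apply: cvg_norm.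
    rewrite /v expr2 (_ : vk = fun k => `|B (g k)| * `|B (g k)|).
      exact: cvgM.
    by apply/funext => k; rewrite /vk expr2.
  (* The variances are known to be positive only from [N] on, whence the shift before dividing by
     them. The factors [c k] make all laws equal, as [limit_law] requires, and tend to 1. *)
  have [N _ vkN] : \forall k \near \oo, 0 < vk k by exact: (cvgr_gt _ cvk).
  have vkN0 k : 0 < vk (k + N)%N by apply: vkN; rewrite /= leq_addl.
  pose c k := Num.sqrt (v / vk (k + N)%N).
  have cc : c @ \oo --> (1 : R).
    have vn0 : v != 0 by rewrite gt_eqF.
    have h1 : (fun k => vk (k + N)%N) @ \oo --> v by rewrite (cvg_shiftn N).
    have h2 : (fun k => v / vk (k + N)%N) @ \oo --> v / v.
      by apply: cvgM; [exact: cvg_cst|exact: cvgV].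
    rewrite -sqrtr1 -(divff vn0).
    exact: (@cvg_comp _ _ _ _ Num.sqrt _ _ _ h2 (@sqrt_continuous R (v / v))).
  apply: (limit_law (mu := mu) (nu := normal_prob 0 (Num.sqrt v)) (G := G)
    (g := fun k x => inner x (c k *: g (k + N)%N))) => //.
  - exact: (measurableT_comp (measurable_fun_innerl h) my).
  - by move=> k; exact: measurable_fun_innerl.
  - move=> x Gx; rewrite -[X in _ --> X]mul1r.
    have -> : (fun k => inner x (c k *: g (k + N)%N)) =
        (fun k => c k * inner (s (nk (k + N)%N) x) h).
      by apply/funext => k; rewrite innerZr inners.
    apply: cvgM => //.
    have hc := @cvg_innerl _ _ _ _ h (cy _ Gx).
    by rewrite -(cvg_shiftn N) in hc.
  - move=> k E mE; rewrite gmu//.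
    have -> : inner (A (c k *: g (k + N)%N)) (c k *: g (k + N)%N) = v.
      rewrite linZ// innerZl innerZr innerA -/(vk _) mulrA -expr2.
      by rewrite sqr_sqrtr ?divr_ge0// ?ltW// divfK// gt_eqF.
    by rewrite /normal_law gt_eqF.
Unshelve. all: by end_near. Qed.

End gaussian_image.

(** * Pulling the construction back along the random variable *)

Theorem theorem5p2 (R : realType) (H : hilbertType R)
    (Hinf : infinite_dimensional H) (Hsep : separable H)
    (A : H -> H) (HA : psd_trace_class A)
    (d : measure_display) (Omega : measurableType d) (P : probability Omega R)
    (X : {RV P >-> borelType H}) (HX : gaussian A (distribution P X))
    (T : partial_op H) (HT : unbounded_op (closure (range A)) T)
    (Tclosable : closable (closure (range A)) T)
    (THS_range : range (sqrt_op A) `<=` dom T)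
    (THS : hilbert_schmidt (T \o sqrt_op A))
    (T' : partial_op H) (HT' : unbounded_op (closure (range A)) T')
    (Text : extension (closure_op T) T') :
  {ae P, forall w, dom T' (X w)} /\
  ae_gaussian P ((T \o sqrt_op A) \o adjoint (T \o sqrt_op A))
    (fun w => T' (X w)).
Proof.
have [sA pA [bA _]] := HA.
have [y [G [my mG G0 Gy law]]] :=
  gaussian_closable_image bA sA pA HX THS_range THS.
(* Closability makes [closure (graph T)] the graph of [closure_op T], which [T'] extends. *)
have GT' x : G x -> dom T' x /\ y x = T' x.
  by move=> /Gy; rewrite -(graph_closure_op Tclosable) => /Text.
have negG : P.-negligible (X @^-1` (~` G)).
  exists (X @^-1` (~` G)); split=> //.
  by apply: measurable_funPTI => //; exact: measurableC.
split.
  by apply: negligibleS negG => w /= nT GX; apply: nT; have [] := GT' _ GX.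
(* [T' (X w)] need not be measurable in [w]; [Z] is, and the two agree off the null set where [X]
   misses [G]. *)
pose Z : Omega -> borelType H := y \o X.
have mZ : measurable_fun setT Z by exact: measurableT_comp.
pose Y : {RV P >-> borelType H} :=
  HB.pack_for {mfun Omega >-> borelType H} Z (@isMeasurableFun.Build _ _ _ _ Z mZ).
exists Y; split.
  by apply: negligibleS negG => w /= nT GX; apply: nT; have [] := GT' _ GX.
by move=> h B mB; exact: law.
Qed.
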